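(* Consider the Downsian election game with informed candidates (as specified in the context). Assume the joint signal distribution $F_{s_A,s_B}$ satisfies: for each $i\in\{A,B\}$ and every bounded measurable $g:S_{-i}\to\mathbb{R}$, if $\mathbb{E}[g(s_{-i})\mid s_i]=0$ for $F_{s_i}$-a.e. $s_i$, then $\Pr(g(s_{-i})=0\mid s_i)=1$ for $F_{s_i}$-a.e. $s_i$. Consider any equilibrium $(y_A,y_B,w_A)$. Then there is a candidate $i\in\{A,B\}$ such that the voter's welfare in this equilibrium is the same as if candidate $i$ were elected no matter which policies are proposed using $(y_A,y_B)$; that is, the voter's ex-ante expected utility $v(y_A,y_B,w_A)$ equals $v_i(y_A,y_B):=\mathbb{E}[u(y_i(s_i),\theta)]$.
   Context: Downsian election game. A voter has von Neumann–Morgenstern utility $u:X\times\Theta\to\mathbb{R}$ over the implemented policy $x\in X$ and an unknown state $\theta\in\Theta$, where $X,\Theta$ are standard Borel spaces; $\theta$ is drawn from a probability measure $F_\theta$; $\mathbb{E}|u(x,\theta)|<\infty$ for all $x\in X$ under $F_\theta$; there is a utility-maximizing policy in each state and an expected-utility-maximizing policy under the prior. There are two candidates $A,B$ ($-i$ denotes the one other than $i$). Given $\theta$, each candidate $i$ privately observes a signal $s_i\in S_i$, a closed subset of $\mathbb{R}^n$, $n\ge 1$; $(s_A,s_B)$ has conditional joint distribution $F_{s_A,s_B\mid\theta}$, inducing an unconditional joint distribution $F_{s_A,s_B}$ with marginals $F_{s_A},F_{s_B}$. $F_{s_A,s_B}$ is absolutely continuous with respect to $F_{s_A}\otimes F_{s_B}$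 and $F_{s_i}$ has support $S_i$. For each $i$ and $s_i\in S_i$, $\max_{x\in X}\mathbb{E}_\theta[u(x,\theta)\mid s_i]$ exists, and these maximizers admit a measurable selection with finite ex-ante expected utility. After observing their signals, candidates simultaneously choose platforms $x_A,x_B\in X$; the voter observes $(x_A,x_B)$ (but not the signals), updates beliefs about $\theta$, and elects a candidate, who implements his platform. The elected candidate gets utility $1$ and the other $0$. A pure strategy of candidate $i$ is a measurable $y_i:S_i\to X$, restricted to satisfy $\mathbb{E}|u(y_i(s_i),\theta)|<\infty$. A voter strategy is a measurable $w_A:X^2\to[0,1]$, where $w_A(x_A,x_B)$ is the probability that $A$ is elected; $w_B(x_B,x_A):=1-w_A(x_A,x_B)$. An equilibrium is a (weak) perfect Bayesian equilibrium $(y_A,y_B,w_A)$ with pure candidate strategies: (i) for each $i$ and $F_{s_i}$-a.e. $s_i$, $y_i(s_i)$ maximizes candidate $i$'s conditional probability of winning given $s_i$, over platforms in $X$; (ii) the voter's beliefs about $\theta$ are derived from Bayes' rule on path (conditional distribution of $\theta$ given the platforms) and are arbitrary off path; (iii) at every platform pair, the voter elects candidate $i$ with probability one if, under her belief, $x_i$ gives strictly higher expected utility than $x_{-i}$, and may randomize arbitrarily when indifferent. Voter welfare $v(y_A,y_B,w_A)$ is the voter's ex-ante expected utility under the given strategies. *)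

(* Defs.v *)
From HB Require Import structures.
From mathcomp Require Import all_boot all_order all_algebra.
From mathcomp Require Import all_classical all_reals all_analysis.

Set Implicit Arguments.
Unset Strict Implicit.
Unset Printing Implicit Defensive.

Import Order.TTheory GRing.Theory Num.Theory.
Import numFieldNormedType.Exports.

Local Open Scope classical_set_scope.
Local Open Scope ring_scope.
Local Open Scope ereal_scope.

(* Up to Borel isomorphism, T is a Polish space: a Hausdorff, second countable,
   complete (pseudo)metric space. *)
Definition standard_borel (R : realType) d (T : measurableType d) : Prop :=
  exists (M : completePseudoMetricType R) (f : T -> M),
    [/\ hausdorff_space M, @second_countable M, bijective f &
        forall A : set T, measurable A <-> <<s @open M >> (f @` A)].

Inductive candidate := CandA | CandB.

Definition opponent (i : candidate) : candidate :=
  match i with CandA => CandB | CandB => CandA end.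

(* The subset S of R^n with its subspace topology. Measurable types are pointed
   in the library, hence the nonemptiness witness; a signal space is nonempty
   anyway, since it carries a probability measure. *)
Definition signal_subspace (R : realType) (n : nat) (S : set 'rV[R]_n)
  (S0 : S !=set0) : Type := S.

Section signal_subspace_instances.
Context (R : realType) (n : nat) (S : set 'rV[R]_n) (S0 : S !=set0).

HB.instance Definition _ := Topological.copy (signal_subspace S0) S.
HB.instance Definition _ := isPointed.Build (signal_subspace S0)
  (SigSub (mem_set (projT2 (cid S0))) : S).

End signal_subspace_instances.

Definition signal_space (R : realType) (n : nat) (S : set 'rV[R]_n)
  (S0 : S !=set0) : Type := g_sigma_algebraType (@open (signal_subspace S0)).

HB.instance Definition _ (R : realType) (n : nat) (S : set 'rV[R]_n)
    (S0 : S !=set0) :=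
  Measurable.copy (signal_space S0)
    (g_sigma_algebraType (@open (signal_subspace S0))).

Definition signal_val (R : realType) (n : nat) (S : set 'rV[R]_n)
  (S0 : S !=set0) (s : signal_space S0) : 'rV[R]_n := set_val (s : S).

(* k is a regular conditional distribution of Y given Z under P. *)
Definition is_cond_dist (R : realType) d d1 d2 (W : measurableType d)
    (T1 : measurableType d1) (T2 : measurableType d2) (P : set W -> \bar R)
    (Z : W -> T1) (Y : W -> T2) (k : R.-pker T1 ~> T2) : Prop :=
  forall (C : set T1) (D : set T2), measurable C -> measurable D ->
    P (Z @^-1` C `&` Y @^-1` D) = \int[P]_(w in Z @^-1` C) k (Z w) D.

(* [posterior i] is a fixed version of the conditional distribution of
   (theta, s_{-i}) given s_i (see [posterior_cond_dist] below); such a version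
   exists because all the spaces involved are standard Borel. *)
Record game (R : realType) dX dTheta (X : measurableType dX)
    (Theta : measurableType dTheta) := Game {
  utility : X * Theta -> R;
  prior : probability Theta R;
  signal_dim : nat;
  signals : candidate -> set 'rV[R]_signal_dim;
  signals_neq0 : forall i, signals i !=set0;
  signal_kernel : R.-pker Theta ~>
    (signal_space (signals_neq0 CandA) * signal_space (signals_neq0 CandB))%type;
  posterior : forall i, R.-pker (signal_space (signals_neq0 i)) ~>
    (Theta * signal_space (signals_neq0 (opponent i)))%type
}.

Arguments signals {R dX dTheta X Theta} g i _ : rename.

Notation signal G i := (signal_space (signals_neq0 G i)).

Section joint_law.
Context (R : realType) dX dTheta (X : measurableType dX)
  (Theta : measurableType dTheta) (G : game R X Theta).

Local Notation Omega := (Theta * (signal G CandA * signal G CandB))%type.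

Definition joint_law : set Omega -> \bar R :=
  fun C => \int[prior G]_t signal_kernel G t (xsection C t).

Let joint_law0 : joint_law set0 = 0.
Proof. by apply: integral0_eq => t _; rewrite xsection0 measure0. Qed.

Let joint_law_ge0 C : 0 <= joint_law C.
Proof. by apply: integral_ge0 => t _; exact: measure_ge0. Qed.

Let joint_law_sigma_additive : semi_sigma_additive joint_law.
Proof.
move=> F mF tF mUF; rewrite [X in _ --> X](_ : _ =
    \sum_(n <oo) joint_law (F n)); last first.
  rewrite /joint_law -integral_nneseries//; last first.
    by move=> n; exact: measurable_fun_xsection_finite_kernel (mem_set (mF n)).
  apply: eq_integral => t _; rewrite xsection_bigcup; apply/esym/cvg_lim => //.
  apply: (measure_sigma_additive _ (trivIset_xsection tF)) => n.
  exact: measurable_xsection.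
exact: is_cvg_nneseries.
Qed.

HB.instance Definition _ := isMeasure.Build _ _ _ joint_law
  joint_law0 joint_law_ge0 joint_law_sigma_additive.

Let joint_law_setT : joint_law setT = 1.
Proof.
rewrite /joint_law (eq_integral (cst 1)).
  by rewrite integral_cst//= mul1e; exact: probability_setT.
move=> t _; rewrite (_ : xsection setT t = setT) ?prob_kernel//.
by apply/seteqP; split=> // z _; rewrite /xsection/= inE.
Qed.

HB.instance Definition _ :=
  Measure_isProbability.Build _ _ _ joint_law joint_law_setT.

End joint_law.

Arguments joint_law {R dX dTheta X Theta} G _.

Section downsian_game.
Context (R : realType) dX dTheta (X : measurableType dX)
  (Theta : measurableType dTheta) (G : game R X Theta).

Local Notation Omega := (Theta * (signal G CandA * signal G CandB))%type.
Local Notation u := (utility G).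
Local Notation P := (joint_law G).

Definition state_of (w : Omega) : Theta := w.1.

Definition signal_of (i : candidate) : Omega -> signal G i :=
  match i with CandA => fun w => w.2.1 | CandB => fun w => w.2.2 end.

Definition signal_law (i : candidate) : set (signal G i) -> \bar R :=
  pushforward P (signal_of i).
Local Arguments signal_law : clear implicits.

Definition joint_signal_law : set (signal G CandA * signal G CandB) -> \bar R :=
  pushforward P snd.

(* The support, in R^n, of the law of s_i. *)
Definition signal_support (i : candidate) : set 'rV[R]_(signal_dim G) :=
  [set r | forall U : set 'rV[R]_(signal_dim G), open U -> U r ->
     0 < P [set w | U (signal_val (signal_of i w))]].

Definition state_posterior (i : candidate) (s : signal G i) :
  set Theta -> \bar R := pushforward (posterior G i s) fst.

Definition exp_utility (mu : set Theta -> \bar R) (x : X) : \bar R :=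
  \int[mu]_t (u (x, t))%:E.

(* The integral is meaningful in [-oo, +oo]: not both of the positive and the
   negative part have infinite integral. *)
Definition exp_utility_defined (mu : set Theta -> \bar R) (x : X) : Prop :=
  \int[mu]_t (Order.max (u (x, t)) 0)%:E < +oo \/
  \int[mu]_t (Order.max (- u (x, t))%R 0)%:E < +oo.

Definition maximizes_exp_utility (mu : set Theta -> \bar R) (x : X) : Prop :=
  mu.-integrable setT (fun t => (u (x, t))%:E) /\
  forall x', exp_utility_defined mu x' -> exp_utility mu x' <= exp_utility mu x.

Definition strictly_prefers (mu : set Theta -> \bar R) (x x' : X) : Prop :=
  [/\ exp_utility_defined mu x, exp_utility_defined mu x' &
      exp_utility mu x' < exp_utility mu x].

Definition platform_utility (i : candidate) (yi : signal G i -> X) (w : Omega)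
  : R := u (yi (signal_of i w), state_of w).

Definition pure_strategy (i : candidate) (yi : signal G i -> X) : Prop :=
  measurable_fun setT yi /\
  P.-integrable setT (EFin \o platform_utility yi).

Record standing_assumptions : Prop := StandingAssumptions {
  policies_standard_borel : standard_borel R X ;
  states_standard_borel : standard_borel R Theta ;
  measurable_utility : measurable_fun setT u ;
  integrable_utility : forall x,
    (prior G).-integrable setT (fun t => (u (x, t))%:E) ;
  state_optimum : forall t, exists x, forall x', (u (x', t) <= u (x, t))%R ;
  prior_optimum : exists x, maximizes_exp_utility (prior G) x ;
  dim_gt0 : (0 < signal_dim G)%N ;
  signals_closed : forall i, closed (signals G i) ;
  signals_support : forall i, signal_support i = signals G i ;
  joint_signal_ac :
    joint_signal_law `<< (signal_law CandA \x signal_law CandB) ;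
  posterior_cond_dist : forall i, is_cond_dist P (signal_of i)
    (fun w => (state_of w, signal_of (opponent i) w)) (posterior G i) ;
  signal_optimum : forall i (s : signal G i),
    exists x, maximizes_exp_utility (state_posterior s) x ;
  signal_optimum_selection : forall i, exists yi : signal G i -> X,
    pure_strategy yi /\
    forall s, maximizes_exp_utility (state_posterior s) (yi s)
}.

(* [w_A] is the voter strategy; [win_prob w_A i x x'] is the probability that i
   is elected when i proposes x and the opponent proposes x'. *)
Definition win_prob (w_A : X * X -> R) (i : candidate) (x x' : X) : R :=
  match i with CandA => w_A (x, x') | CandB => (1 - w_A (x', x))%R end.

Definition voter_strategy (w_A : X * X -> R) : Prop :=
  measurable_fun setT w_A /\ forall z, (0 <= w_A z <= 1)%R.

Definition platforms (y : forall i, signal G i -> X) (w : Omega) : X * X :=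
  (y CandA (signal_of CandA w), y CandB (signal_of CandB w)).

Definition cond_win_prob (y : forall i, signal G i -> X) (w_A : X * X -> R)
    (i : candidate) (s : signal G i) (x : X) : \bar R :=
  \int[posterior G i s]_z (win_prob w_A i x (y (opponent i) z.2))%:E.

(* Beliefs agree with a version of the conditional distribution of theta given
   the platforms at almost every realized platform pair, and are unrestricted
   elsewhere. *)
Definition bayes_consistent (y : forall i, signal G i -> X)
    (belief : X * X -> probability Theta R) : Prop :=
  exists k : R.-pker (X * X)%type ~> Theta,
    is_cond_dist P (platforms y) state_of k /\
    {ae P, forall w, forall D, measurable D ->
       belief (platforms y w) D = k (platforms y w) D}.

Definition voter_optimal (belief : X * X -> probability Theta R)
    (w_A : X * X -> R) : Prop :=
  forall x_A x_B,
    (strictly_prefers (belief (x_A, x_B)) x_A x_B -> w_A (x_A, x_B) = 1%R) /\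
    (strictly_prefers (belief (x_A, x_B)) x_B x_A -> w_A (x_A, x_B) = 0%R).

Record equilibrium (y : forall i, signal G i -> X) (w_A : X * X -> R) : Prop :=
    Equilibrium {
  eq_pure_strategy : forall i, pure_strategy (y i) ;
  eq_voter_strategy : voter_strategy w_A ;
  eq_candidate_optimal : forall i, {ae signal_law i, forall s, forall x,
    cond_win_prob y w_A s x <= cond_win_prob y w_A s (y i s)} ;
  eq_voter_optimal : exists belief : X * X -> probability Theta R,
    bayes_consistent y belief /\ voter_optimal belief w_A
}.

Definition welfare (y : forall i, signal G i -> X) (w_A : X * X -> R)
    : \bar R :=
  'E_P[fun w => (w_A (platforms y w) * platform_utility (y CandA) w +
                 (1 - w_A (platforms y w)) * platform_utility (y CandB) w)%R].

Definition candidate_welfare (y : forall i, signal G i -> X) (i : candidate)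
    : \bar R := 'E_P[platform_utility (y i)].

Definition complete_signals : Prop :=
  forall (i : candidate) (g : signal G (opponent i) -> R),
    measurable_fun setT g -> (exists M : R, forall s, (`|g s| <= M)%R) ->
    {ae signal_law i, forall s, \int[posterior G i s]_z (g z.2)%:E = 0} ->
    {ae signal_law i, forall s, posterior G i s [set z | g z.2 = 0%R] = 1}.

End downsian_game.

(* Main.v *)
(* Let V be A's equilibrium winning probability. For any constant platform of
   A, in particular y_A(s') with s' independent of s_B, candidate optimality gives a
   winning probability of at most V; averaging over s', and using B's deviations
   for the reverse inequality, independent signals also yield exactly V. Hence
   almost every platform y_A(s') is ex ante, and therefore interim, an optimal
   reply for almost every type of A. The difference of two such platforms'
   winning probabilities against y_B(s_B) has zero conditional mean given s_A, so
   by completeness it vanishes: w_A(y_A(s'), y_B(t)) does not depend on s', and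
   symmetrically not on t, up to null sets of the product of the marginals. By
   absolute continuity A is elected on path with a constant probability c. If c
   is 1 or 0, one candidate is always elected; otherwise the voter is indifferent
   on path and both candidates give the same welfare. *)

Require Import Defs.
From HB Require Import structures.
From mathcomp Require Import all_boot all_order all_algebra.
From mathcomp Require Import all_classical all_reals all_analysis.
From mathcomp Require Import measurable_realfun lra.

Set Implicit Arguments.
Unset Strict Implicit.
Unset Printing Implicit Defensive.

Import Order.TTheory GRing.Theory Num.Theory.

Local Open Scope classical_set_scope.
Local Open Scope ring_scope.
Local Open Scope ereal_scope.

(** * Disintegration along a regular conditional distribution *)

Section graph_kernel.
Context (R : realType) d d1 d2 (W : measurableType d) (T1 : measurableType d1)
  (T2 : measurableType d2) (Z : W -> T1) (k : R.-pker T1 ~> T2).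

(* The law of [(Z w, y)] with [y] drawn from [k (Z w)]; the dummy [unit] is the
   parameter of the kernel with which it is composed below. *)
Definition graph_kernel (x : unit * W) (C : set (T1 * T2)) : \bar R :=
  k (Z x.2) (xsection C (Z x.2)).

Let graph_kernel0 x : graph_kernel x set0 = 0.
Proof. by rewrite /graph_kernel xsection0 measure0. Qed.

Let graph_kernel_ge0 x C : 0 <= graph_kernel x C.
Proof. exact: measure_ge0. Qed.

Let graph_kernel_sigma_additive x : semi_sigma_additive (graph_kernel x).
Proof.
move=> F mF tF mUF; rewrite /graph_kernel xsection_bigcup.
apply: (measure_sigma_additive _ (trivIset_xsection tF)) => n.
exact: measurable_xsection.
Qed.

HB.instance Definition _ x := isMeasure.Build _ _ _ (graph_kernel x)
  (graph_kernel0 x) (graph_kernel_ge0 x) (@graph_kernel_sigma_additive x).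

(** The proof argument carries the measurability of [Z], on which the kernel structures attached to
    this name depend. *)
Definition mgraph_kernel of measurable_fun setT Z :
  unit * W -> {measure set (T1 * T2) -> \bar R} := graph_kernel.

Hypothesis mZ : measurable_fun setT Z.

Let measurable_graph_kernel C : measurable C ->
  measurable_fun setT (mgraph_kernel mZ ^~ C).
Proof.
move=> mC; apply: measurableT_comp
  (measurable_fun_xsection_finite_kernel k (mem_set mC)) _.
exact: measurableT_comp.
Qed.

HB.instance Definition _ := @isKernel.Build _ _ (unit * W)%type (T1 * T2)%type R
  (mgraph_kernel mZ) measurable_graph_kernel.

Let mgraph_kernel_prob x : mgraph_kernel mZ x setT = 1.
Proof.
rewrite /= /graph_kernel (_ : xsection setT _ = setT) ?prob_kernel//.
by apply/seteqP; split=> // y _; rewrite /xsection/= inE.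
Qed.

HB.instance Definition _ := @Kernel_isProbability.Build _ _ (unit * W)%type
  (T1 * T2)%type R (mgraph_kernel mZ) mgraph_kernel_prob.

End graph_kernel.

Section cond_dist.
Context (R : realType) d d1 d2 (W : measurableType d) (T1 : measurableType d1)
  (T2 : measurableType d2) (P : probability W R) (Z : W -> T1) (Y : W -> T2)
  (k : R.-pker T1 ~> T2).
Hypotheses (mZ : measurable_fun setT Z) (mY : measurable_fun setT Y)
  (kP : is_cond_dist P Z Y k).

Let mZY : measurable_fun setT (fun w => (Z w, Y w)).
Proof. exact: measurable_fun_pair. Qed.

Let base : R.-pker unit ~> W :=
  kprobability (measurable_cst (P : pprobability W R)).

(** Both sides are finite measures in [C]. By [is_cond_dist] they agree on measurable rectangles, a
    generating class stable under intersection. *)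
Lemma cond_dist_measure (C : set (T1 * T2)) : measurable C ->
  P ((fun w => (Z w, Y w)) @^-1` C) = kcomp base (mgraph_kernel k mZ) tt C.
Proof.
move=> mC.
pose mu := mkcomp base (mgraph_kernel k mZ) tt.
pose nu := measure_function_pushforward__canonical__measure_function_Measure P mZY.
apply: (measure_unique [set A `*` B | A in measurable & B in measurable]
  (fun=> setT) _ _ _ _ nu mu) => //.
- exact: measurable_prod_measurableType.
- move=> _ _ [A1 mA1 [A2 mA2 <-]] [B1 mB1 [B2 mB2 <-]]; rewrite -setXI.
  by exists (A1 `&` B1); [exact: measurableI|exists (A2 `&` B2); [exact: measurableI|]].
- by move=> _; exists setT => //; exists setT => //; rewrite setXTT.
- by rewrite bigcup_const.
- move=> _ [A mA [B mB <-]].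
  transitivity (\int[P]_(w in Z @^-1` A) k (Z w) B); first exact: kP.
  (* The section of [A]*[B] at [Z w] is [B] if [Z w] lies in [A] and empty otherwise, which
     restricts the integral to the preimage of [A]. *)
  rewrite integral_mkcond; apply: eq_integral => w _.
  rewrite patchE /= /graph_kernel /=; case: ifPn => [/set_mem ZA|].
    by rewrite in_xsectionX// mem_set.
  rewrite notin_setE => ZA; rewrite notin_xsectionX ?measure0//.
  by apply/negP => /set_mem.
- by move=> _; rewrite [X in X < _](@probability_setT _ _ _ P) ltry.
Qed.

Lemma ge0_cond_dist_integral (f : T1 * T2 -> \bar R) :
  measurable_fun setT f -> (forall z, 0 <= f z) ->
  \int[P]_w f (Z w, Y w) = \int[P]_w \int[k (Z w)]_y f (Z w, y).
Proof.
move=> mf f0.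
transitivity (\int[kcomp base (mgraph_kernel k mZ) tt]_z f z).
  transitivity (\int[pushforward P (fun w => (Z w, Y w))]_z f z).
    by rewrite ge0_integral_pushforward.
  by apply: eq_measure_integral => C mC _; exact: cond_dist_measure.
rewrite integral_kcomp//; apply: eq_integral => w _.
(* The graph kernel at [w] is the image of [k (Z w)] under [y |-> (Z w, y)]. *)
transitivity (\int[pushforward (k (Z w)) (pair (Z w))]_z f z).
  apply: eq_measure_integral => C mC _ /=.
  by rewrite /graph_kernel/= xsectionE.
by rewrite ge0_integral_pushforward//; exact: pair1_measurable.
Qed.

End cond_dist.

Section cond_dist_integrable.
Context (R : realType) d d1 d2 (W : measurableType d) (T1 : measurableType d1)
  (T2 : measurableType d2) (P : probability W R) (Z : W -> T1) (Y : W -> T2)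
  (k : R.-pker T1 ~> T2).
Hypotheses (mZ : measurable_fun setT Z) (mY : measurable_fun setT Y)
  (kP : is_cond_dist P Z Y k).

Lemma measurable_ge0_kernel_integral (f : T1 * T2 -> \bar R) :
  measurable_fun setT f -> (forall z, 0 <= f z) ->
  measurable_fun setT (fun w => \int[k (Z w)]_y f (Z w, y)).
Proof.
move=> mf f0.
exact: measurableT_comp (measurable_fun_integral_finite_kernel _ _ f0 mf) mZ.
Qed.

Variable f : T1 * T2 -> \bar R.
Hypotheses (mf : measurable_fun setT f)
  (fint : P.-integrable setT (fun w => f (Z w, Y w))).

Let kernel_integralE : (fun w => \int[k (Z w)]_y f (Z w, y)) =
  (fun w => \int[k (Z w)]_y f^\+ (Z w, y)) \-
  (fun w => \int[k (Z w)]_y f^\- (Z w, y)).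
Proof.
apply/funext => w; rewrite integralE -[fun y => f _]/(f \o pair (Z w)).
by rewrite funepos_comp funeneg_comp.
Qed.

Let mpos : measurable_fun setT f^\+. Proof. exact: measurable_funepos. Qed.

Let mneg : measurable_fun setT f^\-. Proof. exact: measurable_funeneg. Qed.

Lemma measurable_kernel_integral :
  measurable_fun setT (fun w => \int[k (Z w)]_y f (Z w, y)).
Proof.
by rewrite kernel_integralE; apply: emeasurable_funB;
  exact: measurable_ge0_kernel_integral.
Qed.

Lemma cond_dist_integrable (g : T1 * T2 -> \bar R) :
  measurable_fun setT g -> (forall z, 0 <= g z) ->
  P.-integrable setT (fun w => g (Z w, Y w)) ->
  P.-integrable setT (fun w => \int[k (Z w)]_y g (Z w, y)).
Proof.
move=> mg g0 /integrableP[_ gint]; apply/integrableP; split.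
  exact: measurable_ge0_kernel_integral.
under eq_integral do rewrite gee0_abs ?integral_ge0//.
rewrite -(ge0_cond_dist_integral mZ mY kP)//.
by move: gint; under eq_integral do rewrite gee0_abs//.
Qed.

(** The conditional integral of the absolute value of [f] is itself [P]-integrable, hence finite
    almost everywhere. *)
Lemma cond_dist_ae_integrable :
  {ae P, forall w, (k (Z w)).-integrable setT (fun y => f (Z w, y))}.
Proof.
have mabs : measurable_fun setT (abse \o f) by exact: measurableT_comp.
have := cond_dist_integrable mabs (fun=> abse_ge0 _) (integrable_abse fint).
move=> /integrable_ae => /(_ measurableT); apply: filterS => w /(_ I) fin.
apply/integrableP; split; first exact: measurable_fun_pair2.
by rewrite ltey_eq fin.
Qed.

(** The nonnegative case applies to [f^\+] and [f^\-]; integrability of [f] makes both conditional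
    integrals integrable, so they may be subtracted. *)
Lemma cond_dist_integral :
  \int[P]_w f (Z w, Y w) = \int[P]_w \int[k (Z w)]_y f (Z w, y).
Proof.
have posE : (fun w => f (Z w, Y w))^\+ = fun w => f^\+ (Z w, Y w).
  exact: (funepos_comp f (fun w => (Z w, Y w))).
have negE : (fun w => f (Z w, Y w))^\- = fun w => f^\- (Z w, Y w).
  exact: (funeneg_comp f (fun w => (Z w, Y w))).
rewrite integralE posE negE kernel_integralE integralB//.
- by rewrite -!(ge0_cond_dist_integral mZ mY kP).
- by apply: cond_dist_integrable => //; rewrite -posE; exact: integrable_funepos.
- by apply: cond_dist_integrable => //; rewrite -negE; exact: integrable_funeneg.
Qed.

End cond_dist_integrable.

(** * Almost-everywhere statements under a probability *)

Section probability_facts.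
Context (R : realType) d (T : measurableType d) (mu : probability T R).

Lemma integrable_itv01 (f : T -> \bar R) : measurable_fun setT f ->
  (forall x, 0 <= f x <= 1) -> mu.-integrable setT f.
Proof.
move=> mf f01.
apply: (le_integrable measurableT mf _ (finite_measure_integrable_cst mu 1 measurableT)).
by move=> x _ /=; have /andP[f0 f1] := f01 x; rewrite gee0_abs// normr1.
Qed.

Lemma ae_ex (A : set T) : {ae mu, forall x, A x} -> exists x, A x.
Proof.
apply: (@filter_ex _ (almost_everywhere mu)).
apply: (@ae_properfilter_algebraOfSetsType _ _ _ mu).
by rewrite [ltRHS](@probability_setT _ _ _ mu) lte01.
Qed.

(** The difference [g \- f] is almost everywhere nonnegative and has integral zero. This serves to
    turn a payoff bound that is tight on average into an almost sure equality. *)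
Lemma ae_eq_of_le (f g : T -> \bar R) :
  mu.-integrable setT f -> mu.-integrable setT g ->
  {ae mu, forall x, f x <= g x} ->
  \int[mu]_x f x = \int[mu]_x g x -> {ae mu, forall x, f x = g x}.
Proof.
move=> fint gint fg eqfg.
have hint : mu.-integrable setT (g \- f) by exact: integrableB.
have mh := measurable_int _ hint.
have ae_fin h : mu.-integrable setT h -> {ae mu, forall x, h x \is a fin_num}.
  by move=> /(integrable_ae measurableT); apply: filterS => x; exact.
have ffin := ae_fin f fint; have gfin := ae_fin g gint.
have : \int[mu]_x `|(g \- f) x| = 0.
  transitivity (\int[mu]_x (g \- f) x).
    apply: ae_eq_integral => //; first exact: measurableT_comp.
    apply: filterS2 fg ffin => x fgx fx _ /=.
    by rewrite gee0_abs// suber_ge0.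
  by rewrite integralB// eqfg subee// integrable_fin_num.
move=> /(ae_eq_integral_abs _ measurableT mh) h0.
apply: filterS3 h0 ffin gfin => x /(_ I) /eqP + fx gx.
by rewrite sube_eq ?add0e ?fin_num_adde_defl// => /eqP.
Qed.

End probability_facts.

(** * Best replies of one candidate, with platforms indexed by types *)

Section best_reply.
Context (R : realType) d1 d2 d3 (T1 : measurableType d1) (T2 : measurableType d2)
  (Z : measurableType d3) (mu1 : probability T1 R) (mu2 : probability T2 R)
  (k : R.-pker T1 ~> Z) (p : Z -> T2) (phi : T1 * T2 -> R).
Hypotheses (mp : measurable_fun setT p) (mphi : measurable_fun setT phi)
  (phi01 : forall z, (0 <= phi z <= 1)%R).
Hypothesis kE : forall g : T2 -> \bar R, measurable_fun setT g ->
  (forall t, 0 <= g t) ->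
  \int[mu1]_s \int[k s]_z g (p z) = \int[mu2]_t g t.

(** Interim winning probability of type [s] proposing the platform of type [s']: [k s] is the
    posterior of [s], [p] reads off the opponent's signal, and [phi] is the winning probability
    after substituting the strategies. *)
Definition payoff (s s' : T1) : \bar R := \int[k s]_z (phi (s', p z))%:E.

(** Winning probability when every type proposes the platform of [s'], the opponent's signal having
    law [mu2]. *)
Definition ex_ante_payoff (s' : T1) : \bar R := \int[mu2]_t (phi (s', t))%:E.

Definition value : \bar R := \int[mu1]_s payoff s s.

Hypothesis opt : {ae mu1, forall s, forall s', payoff s s' <= payoff s s}.

Let mphi2 s' : measurable_fun setT (fun t => (phi (s', t))%:E).
Proof. by apply/measurable_EFinP; exact: measurable_fun_pair2. Qed.

Let phi_ge0 z : 0 <= (phi z)%:E.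
Proof. by rewrite lee_fin; case/andP: (phi01 z). Qed.

Let payoff01 s s' : 0 <= payoff s s' <= 1.
Proof.
rewrite integral_ge0//=; apply: (@le_trans _ _ (\int[k s]_z cst 1 z)).
  apply: ge0_le_integral => //.
  - exact: measurableT_comp (mphi2 s') mp.
  - by move=> z _; rewrite lee_fin; case/andP: (phi01 (s', p z)).
by rewrite integral_cst// mul1e prob_kernel.
Qed.

Let ex_ante_payoff01 s' : 0 <= ex_ante_payoff s' <= 1.
Proof.
rewrite integral_ge0//=; apply: (@le_trans _ _ (\int[mu2]_t cst 1 t)).
  apply: ge0_le_integral => //.
  by move=> t _; rewrite lee_fin; case/andP: (phi01 (s', t)).
by rewrite integral_cst// mul1e [leLHS](@probability_setT _ _ _ mu2).
Qed.

Let mpayoff s' : measurable_fun setT (payoff ^~ s').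
Proof.
apply: (measurable_fun_integral_finite_kernel
  (fun x : T1 * Z => (phi (s', p x.2))%:E)) => //.
apply: measurableT_comp (mphi2 s') _; exact: measurableT_comp.
Qed.

Let mpayoff_diag : measurable_fun setT (fun s => payoff s s).
Proof.
apply: (measurable_fun_integral_finite_kernel
  (fun x : T1 * Z => (phi (x.1, p x.2))%:E)) => //.
apply/measurable_EFinP; apply: measurableT_comp mphi _.
by apply: measurable_fun_pair => //; exact: measurableT_comp.
Qed.

Let mex_ante_payoff : measurable_fun setT ex_ante_payoff.
Proof.
apply: (measurable_fun_fubini_tonelli_F (EFin \o phi)) => //.
exact/measurable_EFinP.
Qed.

Let int_payoff s' : \int[mu1]_s payoff s s' = ex_ante_payoff s'.
Proof. exact: (kE (mphi2 s')). Qed.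

(** By [kE] the left side is the average of [payoff s s'] over [s], and [opt] bounds this integrand
    by [payoff s s]. *)
Lemma ex_ante_payoff_le_value s' : ex_ante_payoff s' <= value.
Proof.
rewrite -int_payoff; apply: ae_ge0_le_integral => //.
- by move=> s _; case/andP: (payoff01 s s').
- by move=> s _; case/andP: (payoff01 s s).
- by apply: filterS opt => s /(_ s').
Qed.

Hypothesis complete : forall g : T2 -> R, measurable_fun setT g ->
  (exists M : R, forall t, (`|g t| <= M)%R) ->
  {ae mu1, forall s, \int[k s]_z (g (p z))%:E = 0} ->
  {ae mu1, forall s, k s [set z | g (p z) = 0%R] = 1}.

Let phi_integrable s s' : (k s).-integrable setT (fun z => (phi (s', p z))%:E).
Proof.
apply/integrableP; split; first exact: measurableT_comp (mphi2 s') mp.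
under eq_integral do rewrite gee0_abs//.
by case/andP: (payoff01 s s') => _ /le_lt_trans; apply; rewrite ltry.
Qed.

(* The ex-ante payoff is at most the value for every s' and averages to it, so
   almost every s' is optimal ex ante, hence also at almost every interim
   type. *)
Lemma ae_optimal_reply : \int[mu1]_s' ex_ante_payoff s' = value ->
  {ae mu1, forall s', {ae mu1, forall s, payoff s s' = payoff s s}}.
Proof.
move=> valE.
have value01 : 0 <= value <= 1.
  rewrite /value integral_ge0 /=; last by move=> s _; case/andP: (payoff01 s s).
  apply: (@le_trans _ _ (\int[mu1]_s cst 1 s)).
    apply: ge0_le_integral => //.
    - by move=> s _; case/andP: (payoff01 s s).
    - by move=> s _; case/andP: (payoff01 s s).
  by rewrite integral_cst// mul1e [leLHS](@probability_setT _ _ _ mu1).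
have : {ae mu1, forall s', ex_ante_payoff s' = cst value s'}.
  apply: ae_eq_of_le.
  - exact: integrable_itv01.
  - exact: integrable_itv01.
  - by apply: aeW => s'; exact: ex_ante_payoff_le_value.
  - by rewrite integral_cst// [X in _ * X](@probability_setT _ _ _ mu1) mule1.
apply: filterS => s' val_s'; apply: ae_eq_of_le.
- exact: integrable_itv01.
- exact: integrable_itv01.
- by apply: filterS opt => s /(_ s').
- by rewrite int_payoff val_s'.
Qed.

Lemma ae_phi_constant_left : \int[mu1]_s' ex_ante_payoff s' = value ->
  exists s0, {ae mu1, forall s, {ae mu2, forall t, phi (s, t) = phi (s0, t)}}.
Proof.
move=> /ae_optimal_reply reply.
(* Any type whose platform is optimal at almost every interim type serves as reference. *)
have [s0 reply0] := ae_ex reply; exists s0.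
apply: filterS reply => s' reply'.
pose g t := (phi (s', t) - phi (s0, t))%R.
have mg : measurable_fun setT g.
  by apply: measurable_funB; exact: measurable_fun_pair2.
have gb : exists M : R, forall t, (`|g t| <= M)%R.
  exists 1%R => t; rewrite ler_norml /g.
  by case/andP: (phi01 (s', t)); case/andP: (phi01 (s0, t)) => *; lra.
(* At almost every [s] the platforms of [s'] and [s0] both attain [payoff s s], which is finite, so
   the difference integrates to zero. *)
have g0 : {ae mu1, forall s, \int[k s]_z (g (p z))%:E = 0}.
  near=> s.
  under eq_integral do rewrite EFinB.
  rewrite integralB_EFin//; [|exact: phi_integrable..].
  have e' : payoff s s' = payoff s s by near: s.
  have e0 : payoff s s0 = payoff s s by near: s.
  by rewrite -[X in X - _]/(payoff s s') -[X in _ - X]/(payoff s s0) e' e0 subee//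
    ge0_fin_numE ?(le_lt_trans (proj2 (andP (payoff01 s s))))// ?ltry//;
    case/andP: (payoff01 s s).
pose B := g @^-1` [set 0%R].
have mB : measurable B by rewrite -[B]setTI; exact: mg.
have mpB : measurable (p @^-1` B) by rewrite -[_ @^-1` _]setTI; exact: mp.
(* Completeness gives [B] full mass under almost every posterior; averaging by [kE] gives it full
   mass under [mu2]. *)
have B1 : mu2 B = 1.
  transitivity (\int[mu2]_t (\1_B t)%:E); first by rewrite integral_indic// setIT.
  rewrite -kE//; last by apply/measurable_EFinP; exact: measurable_indic.
  transitivity (\int[mu1]_s k s (p @^-1` B)).
    apply: eq_integral => s _.
    by rewrite -(setIT (p @^-1` B)) -integral_indic.
  transitivity (\int[mu1]_s cst 1 s); last first.
    by rewrite integral_cst// mul1e [LHS](@probability_setT _ _ _ mu1).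
  apply: ae_eq_integral => //; first exact: measurable_kernel.
  by apply: filterS (complete mg gb g0) => s + _.
exists (~` B); split; first exact: measurableC.
  by rewrite [LHS](probability_setC mu2)// B1 subee.
move=> t /= neq gt0; apply: neq; apply/eqP.
by rewrite -subr_eq0 -/(g t) gt0.
Unshelve. all: by end_near. Qed.

End best_reply.

(** Tonelli for null sets: the indicator of the complement of [A] has iterated integral zero in one
    order, hence in the other, so almost every section is null. *)
Lemma ae_ae_swap (R : realType) d1 d2 (T1 : measurableType d1)
    (T2 : measurableType d2) (mu1 : probability T1 R) (mu2 : probability T2 R)
    (A : set (T1 * T2)) : measurable A ->
  {ae mu2, forall t, {ae mu1, forall s, A (s, t)}} ->
  {ae mu1, forall s, {ae mu2, forall t, A (s, t)}}.
Proof.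
move=> mA aeA.
have mAC : measurable (~` A) by exact: measurableC.
have m1 : measurable_fun setT (fun z : T1 * T2 => (\1_(~` A) z)%:E : \bar R).
  by apply/measurable_EFinP; exact: measurable_indic.
have sliceE s : \int[mu2]_t (\1_(~` A) (s, t))%:E = mu2 (xsection (~` A) s).
  transitivity (\int[mu2]_t (\1_(xsection (~` A) s) t)%:E).
    by apply: eq_integral => t _; rewrite !indicE mem_xsection.
  by rewrite integral_indic ?setIT//; exact: measurable_xsection.
have int0 : \int[mu1]_s \int[mu2]_t (\1_(~` A) (s, t))%:E = 0 :> \bar R.
  rewrite (fubini_tonelli (fun z => (\1_(~` A) z)%:E))//.
  transitivity (\int[mu2]_t cst 0 t); last by rewrite integral0.
  apply: ae_eq_integral => //; first exact: (measurable_fun_fubini_tonelli_G _ m1).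
  apply: filterS aeA => t aet _.
  transitivity (\int[mu1]_s cst 0 s); last by rewrite integral0.
  apply: ae_eq_integral => //; first exact: (measurable_fun_pair1 _ m1).
  by apply: filterS aet => s As _; rewrite indicE memNset.
have mF : measurable_fun setT
    (fun s => \int[mu2]_t (\1_(~` A) (s, t))%:E : \bar R).
  exact: (measurable_fun_fubini_tonelli_F _ m1).
have : \int[mu1]_s `|\int[mu2]_t (\1_(~` A) (s, t))%:E| = 0.
  by under eq_integral do rewrite gee0_abs ?integral_ge0//.
move=> /(ae_eq_integral_abs _ measurableT mF); apply: filterS => s /(_ I).
rewrite /= sliceE => A0; exists (xsection (~` A) s); split => //.
  exact: measurable_xsection.
by move=> t /= At; rewrite /xsection/= inE.
Qed.

(** * The constant-sum interaction of the two candidates *)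

Section constant_sum.
Context (R : realType) d1 d2 d3 d4 (T1 : measurableType d1)
  (T2 : measurableType d2) (Z1 : measurableType d3) (Z2 : measurableType d4)
  (mu1 : probability T1 R) (mu2 : probability T2 R)
  (k1 : R.-pker T1 ~> Z1) (k2 : R.-pker T2 ~> Z2)
  (p1 : Z1 -> T2) (p2 : Z2 -> T1) (phi : T1 * T2 -> R).
Hypotheses (mp1 : measurable_fun setT p1) (mp2 : measurable_fun setT p2)
  (mphi : measurable_fun setT phi) (phi01 : forall z, (0 <= phi z <= 1)%R).

(** The second player's winning probability, with the player's own type first, so that the
    best-reply results apply to both sides. *)
Let psi (z : T2 * T1) : R := (1 - phi (z.2, z.1))%R.

Hypotheses
  (kE1 : forall g : T2 -> \bar R, measurable_fun setT g -> (forall t, 0 <= g t) ->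
    \int[mu1]_s \int[k1 s]_z g (p1 z) = \int[mu2]_t g t)
  (kE2 : forall g : T1 -> \bar R, measurable_fun setT g -> (forall s, 0 <= g s) ->
    \int[mu2]_t \int[k2 t]_z g (p2 z) = \int[mu1]_s g s)
  (opt1 : {ae mu1, forall s, forall s', payoff k1 p1 phi s s' <= payoff k1 p1 phi s s})
  (opt2 : {ae mu2, forall t, forall t', payoff k2 p2 psi t t' <= payoff k2 p2 psi t t})
  (value_sum : value mu1 k1 p1 phi + value mu2 k2 p2 psi = 1)
  (complete1 : forall g : T2 -> R, measurable_fun setT g ->
    (exists M : R, forall t, (`|g t| <= M)%R) ->
    {ae mu1, forall s, \int[k1 s]_z (g (p1 z))%:E = 0} ->
    {ae mu1, forall s, k1 s [set z | g (p1 z) = 0%R] = 1})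
  (complete2 : forall g : T1 -> R, measurable_fun setT g ->
    (exists M : R, forall s, (`|g s| <= M)%R) ->
    {ae mu2, forall t, \int[k2 t]_z (g (p2 z))%:E = 0} ->
    {ae mu2, forall t, k2 t [set z | g (p2 z) = 0%R] = 1}).

Let mpsi : measurable_fun setT psi.
Proof.
apply: measurable_funB => //; apply: measurableT_comp => //.
exact: measurable_swap.
Qed.

Let psi01 z : (0 <= psi z <= 1)%R.
Proof. by rewrite /psi; case/andP: (phi01 (z.2, z.1)) => *; lra. Qed.

Let phi_ge0 z : 0 <= (phi z)%:E.
Proof. by rewrite lee_fin; case/andP: (phi01 z). Qed.

Let psi_ge0 z : 0 <= (psi z)%:E.
Proof. by rewrite lee_fin; case/andP: (psi01 z). Qed.

Let mphiE : measurable_fun setT (EFin \o phi).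
Proof. exact/measurable_EFinP. Qed.

Let mpsiE : measurable_fun setT (EFin \o psi).
Proof. exact/measurable_EFinP. Qed.

(** Tonelli puts both iterated integrals in the same order, where the integrands add up to 1
    pointwise. This is the counterpart of [value_sum] for independent types. *)
Let ex_ante_sum : \int[mu1]_s ex_ante_payoff mu2 phi s +
  \int[mu2]_t ex_ante_payoff mu1 psi t = 1.
Proof.
rewrite (fubini_tonelli (EFin \o phi))//.
rewrite -ge0_integralD//; last 4 first.
- by move=> t _; apply: integral_ge0 => s _; exact: phi_ge0.
- exact: (measurable_fun_fubini_tonelli_G (EFin \o phi)).
- by move=> t _; apply: integral_ge0 => s _; exact: psi_ge0.
- exact: (measurable_fun_fubini_tonelli_F (EFin \o psi)).
transitivity (\int[mu2]_t cst 1 t); last first.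
  by rewrite integral_cst// mul1e [LHS](@probability_setT _ _ _ mu2).
apply: eq_integral => t _; rewrite -ge0_integralD//; last 3 first.
- by move=> s _; exact: phi_ge0.
- exact: (measurable_fun_pair1 _ mphiE).
- exact: (measurable_fun_pair2 _ mpsiE).
transitivity (\int[mu1]_s cst 1 s); last first.
  by rewrite integral_cst// mul1e [LHS](@probability_setT _ _ _ mu1).
by apply: eq_integral => s _; rewrite /= -EFinD /psi/= addrCA subrr addr0.
Qed.

(** Each average is at most the corresponding value, while the averages and the values both sum to
    1; so neither inequality can be strict. *)
Let ex_ante_value : \int[mu1]_s ex_ante_payoff mu2 phi s = value mu1 k1 p1 phi /\
  \int[mu2]_t ex_ante_payoff mu1 psi t = value mu2 k2 p2 psi.
Proof.
have le1 : \int[mu1]_s ex_ante_payoff mu2 phi s <= value mu1 k1 p1 phi.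
  apply: (@le_trans _ _ (\int[mu1]_s cst (value mu1 k1 p1 phi) s)).
    apply: ge0_le_integral => //.
    - by move=> s _; apply: integral_ge0 => t _; exact: phi_ge0.
    - exact: (measurable_fun_fubini_tonelli_F (EFin \o phi)).
    - by move=> s _; exact: ex_ante_payoff_le_value.
  by rewrite integral_cst// [X in _ * X](@probability_setT _ _ _ mu1) mule1.
have le2 : \int[mu2]_t ex_ante_payoff mu1 psi t <= value mu2 k2 p2 psi.
  apply: (@le_trans _ _ (\int[mu2]_t cst (value mu2 k2 p2 psi) t)).
    apply: ge0_le_integral => //.
    - by move=> t _; apply: integral_ge0 => s _; exact: psi_ge0.
    - exact: (measurable_fun_fubini_tonelli_F (EFin \o psi)).
    - by move=> t _; exact: ex_ante_payoff_le_value.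
  by rewrite integral_cst// [X in _ * X](@probability_setT _ _ _ mu2) mule1.
have ge1 : 0 <= \int[mu1]_s ex_ante_payoff mu2 phi s.
  by apply: integral_ge0 => s _; apply: integral_ge0 => t _; exact: phi_ge0.
have ge2 : 0 <= \int[mu2]_t ex_ante_payoff mu1 psi t.
  by apply: integral_ge0 => t _; apply: integral_ge0 => s _; exact: psi_ge0.
move: le1 le2 ge1 ge2 ex_ante_sum value_sum.
(* All four quantities are finite, being nonnegative with sums equal to 1. *)
case: (\int[mu1]_s _) => [a| |]//; case: (\int[mu2]_t _) => [b| |]//.
case: (value mu1 k1 p1 phi) => [v1| |]//; case: (value mu2 k2 p2 psi) => [v2| |]//.
rewrite !lee_fin -!EFinD => le1 le2 _ _ [e1] [e2].
by split; congr EFin; lra.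
Qed.

Lemma constant_sum_ae_constant : exists c : R,
  (mu1 \x mu2) [set z | phi z != c] = 0.
Proof.
have [val1 val2] := ex_ante_value.
have [s0 cst_s] := ae_phi_constant_left mp1 mphi phi01 kE1 opt1 complete1 val1.
have [t0 cst_t] := ae_phi_constant_left mp2 mpsi psi01 kE2 opt2 complete2 val2.
(* With the quantifiers in the order of [cst_s], a single [s1] can be chosen that is good for both
   statements. *)
have {}cst_t : {ae mu1, forall s, {ae mu2, forall t, phi (s, t) = phi (s, t0)}}.
  apply: (@ae_ae_swap _ _ _ _ _ _ _ [set z | phi z = phi (z.1, t0)]).
    have mdiff : measurable_fun setT (fun z => phi z - phi (z.1, t0))%R.
      apply: measurable_funB => //; apply: measurableT_comp mphi _.
      exact: measurable_fun_pair.
    rewrite (_ : [set z | _] = (fun z => phi z - phi (z.1, t0))%R @^-1` [set 0%R]).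
      by rewrite -[X in measurable X]setTI; exact: mdiff.
    by apply/seteqP; split=> z /= => [->|/eqP]; rewrite ?subrr// subr_eq0 => /eqP.
  apply: filterS cst_t => t; apply: filterS => s.
  by rewrite /psi/= => /eqP; rewrite (inj_eq (addrI _)) eqr_opp => /eqP.
have [s1 [cst_s1 cst_t1]] := ae_ex (filterI cst_s cst_t).
exists (phi (s1, t0)); set N := [set z | _].
have mN : measurable N.
  rewrite (_ : N = phi @^-1` (~` [set phi (s1, t0)])).
    rewrite -[X in measurable X]setTI; apply: mphi => //.
    exact: measurableC.
  by apply/seteqP; split=> z /= /eqP.
transitivity (\int[mu1]_s cst 0 s); last by rewrite integral0.
apply: ae_eq_integral => //; first exact: measurable_fun_xsection.
apply: filterS cst_s => s cst_s _ /=.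
apply: measure_negligible; first exact: measurable_xsection.
(* The chain is [phi (s, t) = phi (s0, t) = phi (s1, t) = phi (s1, t0)]. *)
have : {ae mu2, forall t, phi (s, t) = phi (s1, t0)}.
  apply: filterS3 cst_s cst_s1 cst_t1 => t e e1 e2.
  by rewrite e -e1 e2.
by apply: negligibleS => t; rewrite /xsection/= inE => /eqP.
Qed.

End constant_sum.

Lemma measurable_fst_snd d1 d2 d3 (T1 : measurableType d1)
    (T2 : measurableType d2) (T3 : measurableType d3) :
  measurable_fun setT (fun w : T1 * (T2 * T3) => w.2.1).
Proof. exact: (measurableT_comp measurable_fst measurable_snd). Qed.

Lemma measurable_snd_snd d1 d2 d3 (T1 : measurableType d1)
    (T2 : measurableType d2) (T3 : measurableType d3) :
  measurable_fun setT (fun w : T1 * (T2 * T3) => w.2.2).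
Proof. exact: (measurableT_comp measurable_snd measurable_snd). Qed.

(** * The election game as an instance of the constant-sum setting *)

Section game.
Context (R : realType) dX dTheta (X : measurableType dX)
  (Theta : measurableType dTheta) (G : game R X Theta).

Local Notation Omega := (Theta * (signal G CandA * signal G CandB))%type.
Local Notation u := (utility G).
Local Notation P := (joint_law G : probability Omega R).

Lemma measurable_signal_of i : measurable_fun setT (signal_of (G := G) i).
Proof. by case: i; [exact: measurable_fst_snd|exact: measurable_snd_snd]. Qed.

HB.instance Definition _ i := isMeasurableFun.Build _ _ Omega (signal G i)
  (signal_of i) (@measurable_signal_of i).

(** The measure [signal_law i] packaged as a probability; both unfold to the same pushforward, so
    hypotheses on [signal_law] apply directly. *)
Definition signal_distribution i : probability (signal G i) R :=
  distribution P (signal_of i : {mfun Omega >-> signal G i}).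

Hypothesis HG : standing_assumptions G.

(** An instance of [ge0_cond_dist_integral] whose integrand ignores the state component of the
    posterior. *)
Lemma interim_integral i (f : signal G i * signal G (opponent i) -> \bar R) :
  measurable_fun setT f -> (forall z, 0 <= f z) ->
  \int[signal_distribution i]_s \int[posterior G i s]_z f (s, z.2) =
  \int[P]_w f (signal_of i w, signal_of (opponent i) w).
Proof.
move=> mf f0.
have mf' : measurable_fun setT
    (fun x : signal G i * (Theta * signal G (opponent i)) => f (x.1, x.2.2)).
  apply: measurableT_comp mf _; apply: measurable_fun_pair => //.
  exact: measurable_snd_snd.
have mY : measurable_fun setT
    (fun w => (state_of w, signal_of (G := G) (opponent i) w)).
  apply: measurable_fun_pair; first exact: measurable_fst.
  exact: measurable_signal_of.
rewrite ge0_integral_distribution//; last first.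
- by move=> s; exact: integral_ge0.
- exact: (measurable_fun_integral_finite_kernel _ _ _ mf').
by rewrite [RHS](ge0_cond_dist_integral (@measurable_signal_of i) mY
  (posterior_cond_dist HG (i := i)) mf').
Qed.

Lemma interim_integral_opponent i (g : signal G (opponent i) -> \bar R) :
  measurable_fun setT g -> (forall t, 0 <= g t) ->
  \int[signal_distribution i]_s \int[posterior G i s]_z g z.2 =
  \int[signal_distribution (opponent i)]_t g t.
Proof.
move=> mg g0; rewrite (@interim_integral i (g \o snd))//=.
  by rewrite ge0_integral_distribution.
exact: measurableT_comp.
Qed.

Hypothesis Hcomplete : complete_signals G.
Variables (y : forall i, signal G i -> X) (w_A : X * X -> R).
Arguments y : clear implicits.
Hypothesis Heq : equilibrium y w_A.

Let my i : measurable_fun setT (y i).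
Proof. by have [] := eq_pure_strategy Heq i. Qed.

Let mw : measurable_fun setT w_A.
Proof. by have [] := eq_voter_strategy Heq. Qed.

Let phi (z : signal G CandA * signal G CandB) : R := w_A (y CandA z.1, y CandB z.2).

Let mphi : measurable_fun setT phi.
Proof.
apply: measurableT_comp mw _; apply: measurable_fun_pair;
  exact: measurableT_comp.
Qed.

Let phi01 z : (0 <= phi z <= 1)%R.
Proof. by have [_] := eq_voter_strategy Heq; exact. Qed.

Let psi (z : signal G CandB * signal G CandA) : R := (1 - phi (z.2, z.1))%R.

Let mpsi : measurable_fun setT psi.
Proof.
apply: measurable_funB => //; apply: measurableT_comp mphi _.
exact: measurable_swap.
Qed.

Let psi01 z : (0 <= psi z <= 1)%R.
Proof. by rewrite /psi; case/andP: (phi01 (z.2, z.1)) => *; lra. Qed.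

(** Both values are integrals under the same law [P], where exactly one candidate wins. *)
Let value_sum :
  value (signal_distribution CandA) (posterior G CandA) snd phi +
  value (signal_distribution CandB) (posterior G CandB) snd psi = 1.
Proof.
have EFin_ge0 r : (0 <= r <= 1)%R -> 0 <= r%:E by case/andP; rewrite lee_fin.
have mphiE : measurable_fun setT (EFin \o phi) by exact/measurable_EFinP.
have mpsiE : measurable_fun setT (EFin \o psi) by exact/measurable_EFinP.
rewrite /value /payoff.
rewrite (@interim_integral CandA (EFin \o phi) mphiE); last first.
  by move=> z; exact: EFin_ge0.
rewrite (@interim_integral CandB (EFin \o psi) mpsiE); last first.
  by move=> z; exact: EFin_ge0.
rewrite -ge0_integralD//.
- transitivity (\int[P]_w cst 1 w).
    by apply: eq_integral => w _; rewrite /= -EFinD /psi/= addrCA subrr addr0.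
  by rewrite integral_cst// mul1e [LHS](@probability_setT _ _ _ P).
- by move=> w _; exact: EFin_ge0.
- exact: (measurableT_comp mphiE (@measurable_snd _ _ Theta _)).
- by move=> w _; exact: EFin_ge0.
- apply: measurableT_comp mpsiE _; apply: measurable_fun_pair.
    exact: measurable_snd_snd.
  exact: measurable_fst_snd.
Qed.

(** Proposing the platform of another type is one of the deviations covered by equilibrium. *)
Let phi_optimal : {ae signal_distribution CandA, forall s s',
  payoff (posterior G CandA) snd phi s s' <= payoff (posterior G CandA) snd phi s s}.
Proof.
have opt : {ae signal_distribution CandA, forall s x,
    cond_win_prob y w_A s x <= cond_win_prob y w_A s (y CandA s)}.
  exact: eq_candidate_optimal Heq CandA.
by apply: filterS opt => s opt s'; exact: (opt (y CandA s')).
Qed.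

Let psi_optimal : {ae signal_distribution CandB, forall t t',
  payoff (posterior G CandB) snd psi t t' <= payoff (posterior G CandB) snd psi t t}.
Proof.
have opt : {ae signal_distribution CandB, forall t x,
    cond_win_prob y w_A t x <= cond_win_prob y w_A t (y CandB t)}.
  exact: eq_candidate_optimal Heq CandB.
by apply: filterS opt => t opt t'; exact: (opt (y CandB t')).
Qed.

(** The exceptional set is null for the product of the marginals, and [joint_signal_ac] makes it
    null for the actual joint law. *)
Lemma equilibrium_ae_constant :
  exists c : R, {ae P, forall w, w_A (platforms y w) = c}.
Proof.
have [c c0] := constant_sum_ae_constant measurable_snd measurable_snd mphi phi01
  (@interim_integral_opponent CandA) (@interim_integral_opponent CandB)
  phi_optimal psi_optimal value_sum
  (Hcomplete (i := CandA)) (Hcomplete (i := CandB)).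
exists c.
pose N := [set z | phi z != c].
have mN : measurable N.
  rewrite (_ : N = phi @^-1` (~` [set c])).
    by rewrite -[X in measurable X]setTI; apply: mphi => //; exact: measurableC.
  by apply/seteqP; split=> z /= /eqP.
exists (snd @^-1` N); split.
- by rewrite -[X in measurable X]setTI; apply: measurable_snd.
- exact: (null_content_dominatesP _
    (signal_distribution CandA \x signal_distribution CandB)).1
    (joint_signal_ac HG) N mN c0.
- by move=> w /= /eqP.
Qed.

End game.

(** * From a constant election probability to the voter's welfare *)

Section welfare.
Context (R : realType) dX dTheta (X : measurableType dX)
  (Theta : measurableType dTheta) (G : game R X Theta).

Local Notation Omega := (Theta * (signal G CandA * signal G CandB))%type.
Local Notation u := (utility G).
Local Notation P := (joint_law G : probability Omega R).

(** The positive part is dominated by the absolute value. This supplies the definedness conditions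
    in [strictly_prefers]. *)
Lemma integrable_exp_utility_defined (mu : {measure set Theta -> \bar R}) x :
  mu.-integrable setT (fun t => (u (x, t))%:E) -> exp_utility_defined G mu x.
Proof.
move=> /integrableP[mux intx]; left; apply: le_lt_trans intx.
apply: ge0_le_integral => //.
- by move=> t _; rewrite lee_fin le_max lexx orbT.
- apply/measurable_EFinP; apply: measurable_maxr => //.
  exact/measurable_EFinP.
- exact: measurableT_comp.
- by move=> t _; rewrite lee_fin ge_max normr_ge0 ler_norm.
Qed.

Lemma measurable_platforms (y : forall i : candidate, signal G i -> X) :
  (forall i, pure_strategy (y i)) -> measurable_fun setT (platforms y).
Proof.
move=> py; apply: measurable_fun_pair; apply: measurableT_comp;
  by [case: (py CandA)|case: (py CandB)|exact: measurable_signal_of].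
Qed.

(* Conditioning u(x_A, .) and u(x_B, .) on the platforms gives the on-path
   beliefs, so on-path indifference makes both candidates equally good ex
   ante. *)
Lemma ae_indifferent_candidate_welfare (HG : standing_assumptions G)
    (y : forall i : candidate, signal G i -> X)
    (belief : X * X -> probability Theta R) :
  (forall i, pure_strategy (y i)) -> bayes_consistent y belief ->
  {ae P, forall w, let z := platforms y w in
    ~ strictly_prefers G (belief z) z.1 z.2 /\
    ~ strictly_prefers G (belief z) z.2 z.1} ->
  candidate_welfare y CandA = candidate_welfare y CandB.
Proof.
move=> py [k [kP bk]] indiff.
have mZ := measurable_platforms py.
have mY : measurable_fun setT (state_of (G := G)) by exact: measurable_fst.
pose f1 (z : X * X * Theta) : \bar R := (u (z.1.1, z.2))%:E.
pose f2 (z : X * X * Theta) : \bar R := (u (z.1.2, z.2))%:E.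
have mu := measurable_utility HG.
have mf1 : measurable_fun setT f1.
  apply/measurable_EFinP; apply: measurableT_comp mu _.
  apply: measurable_fun_pair => //.
  exact: (measurableT_comp measurable_fst measurable_fst).
have mf2 : measurable_fun setT f2.
  apply/measurable_EFinP; apply: measurableT_comp mu _.
  apply: measurable_fun_pair => //.
  exact: (measurableT_comp measurable_snd measurable_fst).
have int1 : P.-integrable setT (fun w => f1 (platforms y w, state_of w)).
  by have [] := py CandA.
have int2 : P.-integrable setT (fun w => f2 (platforms y w, state_of w)).
  by have [] := py CandB.
rewrite /candidate_welfare unlock.
transitivity (\int[P]_w \int[k (platforms y w)]_t f1 (platforms y w, t)).
  exact: (cond_dist_integral mZ mY kP mf1 int1).
transitivity (\int[P]_w \int[k (platforms y w)]_t f2 (platforms y w, t)); last first.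
  exact/esym/(cond_dist_integral mZ mY kP mf2 int2).
apply: ae_eq_integral => //.
- exact: measurable_kernel_integral.
- exact: measurable_kernel_integral.
have ae1 := cond_dist_ae_integrable mZ mY kP mf1 int1.
have ae2 := cond_dist_ae_integrable mZ mY kP mf2 int2.
apply: filterS3 (filterI ae1 ae2) bk indiff => w [].
move: (platforms y w) => z /= i1 i2 bkz [nsp12 nsp21] _.
(* On path the belief equals [k z] on measurable sets, so integrals and integrability carry over. *)
have intE (h : Theta -> \bar R) : \int[belief z]_t h t = \int[k z]_t h t.
  by apply: eq_measure_integral => D mD _; exact: bkz.
have integrableE (h : Theta -> \bar R) :
    (k z).-integrable setT h -> (belief z).-integrable setT h.
  by move=> /integrableP[mh hoo]; apply/integrableP; rewrite intE.
have def1 := integrable_exp_utility_defined (integrableE _ i1).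
have def2 := integrable_exp_utility_defined (integrableE _ i2).
rewrite -!intE; apply/eqP; rewrite eq_le !leNgt.
by apply/andP; split; apply/negP => lt; [apply: nsp12|apply: nsp21].
Qed.

End welfare.

Theorem proposition1 (R : realType) (dX dTheta : measure_display)
    (X : measurableType dX) (Theta : measurableType dTheta)
    (G : game R X Theta)
    (HG : standing_assumptions G) (Hcomplete : complete_signals G)
    (y : forall i : candidate, signal G i -> X) (w_A : X * X -> R)
    (Heq : equilibrium y w_A) :
  exists i : candidate, welfare y w_A = candidate_welfare y i.
Proof.
have [c wc] := equilibrium_ae_constant HG Hcomplete Heq.
pose P := joint_law G : probability _ R.
pose v i w := (platform_utility (y i) w)%:E : \bar R.
have py := eq_pure_strategy Heq.
have vint i : P.-integrable setT (v i) by have [] := py i.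
have mv i : measurable_fun setT (platform_utility (y i)).
  by apply/measurable_EFinP; exact: measurable_int (vint i).
have mwp : measurable_fun setT (w_A \o platforms y).
  have [mw _] := eq_voter_strategy Heq.
  by apply: measurableT_comp mw _; exact: measurable_platforms.
have welfareE : welfare y w_A =
    \int[P]_w (c%:E * v CandA w + (1 - c)%:E * v CandB w).
  rewrite /welfare unlock; apply: ae_eq_integral => //.
  - apply/measurable_EFinP; apply: measurable_funD.
      by apply: measurable_funM.
    by apply: measurable_funM => //; exact: measurable_funB.
  - apply: emeasurable_funD; apply: measurable_funeM; exact: measurable_int (vint _).
  - by apply: filterS wc => w wc _; rewrite wc EFinD !EFinM.
(* For [c] equal to 1 or 0 the mixture in [welfareE] reduces to one candidate. *)
have [c1|c1] := eqVneq c 1%R.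
  exists CandA; rewrite welfareE /candidate_welfare unlock.
  by apply: eq_integral => w _; rewrite c1 subrr mul1e mul0e adde0.
have [c0|c0] := eqVneq c 0%R.
  exists CandB; rewrite welfareE /candidate_welfare unlock.
  by apply: eq_integral => w _; rewrite c0 subr0 mul1e mul0e add0e.
have [belief [bayes opt]] := eq_voter_optimal Heq.
(* A strict preference on path would force [c] to be 1 or 0, so the voter is almost surely
   indifferent. *)
have vAB : \int[P]_w v CandA w = \int[P]_w v CandB w.
  have := ae_indifferent_candidate_welfare HG py bayes.
  rewrite /candidate_welfare unlock; apply; apply: filterS wc => w wc /=.
  have [optA optB] := opt (platforms y w).1 (platforms y w).2.
  split=> [/optA|/optB]; rewrite -[w_A _]/(w_A (platforms y w)) wc; exact/eqP.
(* Either candidate would do: the weights [c] and [1 - c] multiply the same finite number. *)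
exists CandA; rewrite welfareE integralD//; last 2 first.
- exact: integrableZl.
- exact: integrableZl.
rewrite !integralZl// -vAB -muleDl ?integrable_fin_num//.
by rewrite -EFinD addrC subrK mul1e /candidate_welfare unlock.
Qed.
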